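(* Let $p>1$ be an integer and let $\alpha\in\Omega_p^{\mathrm{even}}$. Let $\lambda^\alpha:\mathrm{SL}_2(\mathbb Z)\to\mathrm{Aut}(\mathscr A_\alpha^\omega)$ be the canonical action defined on the dense subalgebra $\ell^1(\Gamma_p,\omega_\alpha)$ by $\lambda_M^\alpha(f)(x)=f(M^{-1}x)$ for all $f\in\ell^1(\Gamma_p,\omega_\alpha)$, $x\in\Gamma_p$, and let $\widetilde\pi^\alpha$ be the inductive limit of the Watatani–Brenken actions of $\mathrm{SL}_2(\mathbb Z)$ on the rotation algebras $A_{\alpha_{2n}}$. Then $\lambda_M^\alpha=\widetilde\pi_M^\alpha$ for every $M\in\mathrm{SL}_2(\mathbb Z)$.
   Context: $\mathbb N=\{0,1,2,\dots\}$. $\Gamma_p=\mathbb Z[1/p]\times\mathbb Z[1/p]$ (discrete); elements of $\mathbb Z[1/p]$ are written $j/p^k$ with $k\in\mathbb N$ minimal; matrices act on column vectors in $\Gamma_p$ by multiplication. $\Omega_p^{\mathrm{even}}$ is the set of real sequences $(\alpha_n)_{n\in\mathbb N}$ such that for every $n$ there is $x_n\in2\mathbb Z$ with $p\alpha_{n+1}=\alpha_n+x_n$. For such $\alpha$, $\omega_\alpha$ is the multiplier on $\Gamma_p$ $$\omega_\alpha\left(\left(\tfrac{j_1}{p^{k_1}},\tfrac{j_2}{p^{k_2}}\right),\left(\tfrac{j_3}{p^{k_3}},\tfrac{j_4}{p^{k_4}}\right)\right)=e^{\pi i(\alpha_{k_1+k_4}j_1j_4-\alpha_{k_2+k_3}j_2j_3)},$$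 which is invariant under the action of $\mathrm{SL}_2(\mathbb Z[1/p])$, and $\mathscr A_\alpha^\omega=C^*(\Gamma_p,\omega_\alpha)$ is the twisted group $C^*$-algebra with canonical unitaries $W_x$, $W_xW_y=\omega_\alpha(x,y)W_{x+y}$. For $\theta\in\mathbb R$, $A_\theta$ is the universal $C^*$-algebra generated by unitaries $U,V$ with $VU=e^{2\pi i\theta}UV$. Denote the generators of $A_{\alpha_{2n}}$ by $U_{2n},V_{2n}$. The connecting maps $\varphi_n:A_{\alpha_{2n}}\to A_{\alpha_{2n+2}}$ are the $*$-homomorphisms with $\varphi_n(U_{2n})=U_{2n+2}^p$, $\varphi_n(V_{2n})=V_{2n+2}^p$; $\mathscr A_\alpha^\omega$ is the inductive limit of $(A_{\alpha_{2n}},\varphi_n)$ via the embeddings $\nu_n:A_{\alpha_{2n}}\to\mathscr A_\alpha^\omega$, $\nu_n(V_{2n})=W_{(1/p^n,0)}$, $\nu_n(U_{2n})=W_{(0,1/p^n)}$. For $M=\begin{pmatrix}a&b\\c&d\end{pmatrix}\in\mathrm{SL}_2(\mathbb Z)$, the Watatani–Brenken automorphism $\pi^n_M$ of $A_{\alpha_{2n}}$ is given by $\pi^n_M(V_{2n})=e^{-\pi iac\alpha_{2n}}V_{2n}^aU_{2n}^c$, $\pi^n_M(U_{2n})=e^{-\pi ibd\alpha_{2n}}V_{2n}^bU_{2n}^d$. These satisfy $\varphi_n\circ\pi_M^n=\pi_M^{n+1}\circ\varphi_n$, and $\widetilde\pi_M^\alpha$ is the unique automorphism of $\mathscr A_\alpha^\omega$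 with $\widetilde\pi_M^\alpha\circ\nu_n=\nu_n\circ\pi_M^n$ for all $n$. *)

(* Defs.v *)
From HB Require Import structures.
From mathcomp Require Import all_boot all_order all_algebra.
From mathcomp Require Import complex.
From mathcomp Require Import all_classical all_reals all_analysis.
From mathcomp.analysis.showcase Require summability.

Set Implicit Arguments.
Unset Strict Implicit.
Unset Printing Implicit Defensive.

Import Order.TTheory GRing.Theory Num.Theory.

Local Open Scope ring_scope.
Local Open Scope complex_scope.

Definition cabs (R : realType) (z : R[i]) : R := ComplexField.Normc.normc z.

(* Unital complex C*-algebras. The norm is a field of the mixin because
   Hierarchy Builder rejects a structure inheriting from both GRing.Algebra and
   NormedModule (their join would have to lie below Num.NumDomain).
   GRing.Algebra excludes the zero algebra. This does not affect the universal
   properties below: no nonzero algebra receives a unital map from it, and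
   every algebra has exactly one map to it. *)
HB.mixin Record isCstarAlgebra (R : realType) A of GRing.Algebra R[i] A := {
  star : A -> A ;
  cnorm : A -> R ;
  starK : involutive star ;
  starD : {morph star : x y / x + y} ;
  starZ : forall (c : R[i]) (x : A), star (c *: x) = c^* *: star x ;
  starM : forall x y : A, star (x * y) = star y * star x ;
  cnorm_eq0 : forall x : A, cnorm x = 0 -> x = 0 ;
  cnormD : forall x y : A, cnorm (x + y) <= cnorm x + cnorm y ;
  cnormZ : forall (c : R[i]) (x : A), cnorm (c *: x) = cabs c * cnorm x ;
  cnormM : forall x y : A, cnorm (x * y) <= cnorm x * cnorm y ;
  cnorm_star : forall x : A, cnorm (star x * x) = cnorm x ^+ 2 ;
  cnorm_complete : forall u : nat -> A,
    (forall e : R, 0 < e -> exists N : nat, forall m n : nat,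
       (N <= m)%N -> (N <= n)%N -> cnorm (u m - u n) < e) ->
    exists l : A, forall e : R, 0 < e -> exists N : nat, forall n : nat,
       (N <= n)%N -> cnorm (u n - l) < e }.

#[short(type="cstarType")]
HB.structure Definition CstarAlgebra (R : realType) :=
  {A of isCstarAlgebra R A & GRing.Algebra R[i] A}.

Section CstarAlgebras.
Variable R : realType.

(* e^{it} for t real *)
Definition expi (t : R) : R[i] := (cos t +i* sin t)%C.

Record star_hom (A B : cstarType R) (h : A -> B) : Prop := StarHom {
  star_hom_lin : forall (c : R[i]) (x y : A), h (c *: x + y) = c *: h x + h y ;
  star_homM : forall x y : A, h (x * y) = h x * h y ;
  star_hom1 : h 1 = 1 ;
  star_hom_star : forall x : A, h (star x) = star (h x) }.

Definition star_aut (A : cstarType R) (h : A -> A) : Prop :=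
  star_hom h /\ bijective h.

Definition unitary (A : cstarType R) (u : A) : Prop :=
  star u * u = 1 /\ u * star u = 1.

(* The integer powers of a unitary u, for which u^-1 = star u. *)
Definition upow (A : cstarType R) (u : A) (z : int) : A :=
  match z with
  | Posz n => u ^+ n
  | Negz n => star u ^+ n.+1
  end.

Definition rotation_rel (theta : R) (A : cstarType R) (U V : A) : Prop :=
  [/\ unitary U, unitary V & V * U = expi (2 * pi * theta) *: (U * V)].

(* (A, U, V) is the rotation algebra A_theta: the universal C*-algebra
   generated by unitaries U, V with VU = e^{2 pi i theta} UV. *)
Definition rotation_algebra (theta : R) (A : cstarType R) (U V : A) : Prop :=
  rotation_rel theta U V /\
  forall (B : cstarType R) (U' V' : B), rotation_rel theta U' V' ->
    exists! h : A -> B, [/\ star_hom h, h U = U' & h V = V'].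

End CstarAlgebras.

Section TwistedGroupAlgebra.
Variables (R : realType) (G : zmodType) (omega : G -> G -> R[i]).

Definition l1 (f : G -> R[i]) : Prop :=
  esum.summable [set: G]%classic (fun x => (cabs (f x))%:E).

Definition l1norm (f : G -> R[i]) : R :=
  fine (\esum_(x in [set: G]%classic) (cabs (f x))%:E).

Definition delta (x : G) : G -> R[i] := fun y => (y == x)%:R.

(* [summability.sum] is the unordered sum, i.e. the limit of the net of finite
   partial sums; the series converges absolutely for f and g in l^1. *)
Definition tconv (f g : G -> R[i]) : G -> R[i] := fun x =>
  summability.sum (fun y => f y * g (x - y) * omega y (x - y) : R[i]^o).

Definition tstar (f : G -> R[i]) : G -> R[i] := fun x =>
  (omega x (- x))^* * (f (- x))^*.

(* The contractive unital *-homomorphisms from the Banach *-algebra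
   l^1(G, omega) to A; the values of T outside l^1 are irrelevant.
   *-homomorphisms from Banach *-algebras to C*-algebras are automatically
   contractive. *)
Record l1_rep (A : cstarType R) (T : (G -> R[i]) -> A) : Prop := L1Rep {
  l1_rep_lin : forall (c : R[i]) f g, l1 f -> l1 g ->
    T (fun x => c * f x + g x) = c *: T f + T g ;
  l1_repM : forall f g, l1 f -> l1 g -> T (tconv f g) = T f * T g ;
  l1_rep1 : T (delta 0) = 1 ;
  l1_rep_star : forall f, l1 f -> T (tstar f) = star (T f) ;
  l1_rep_norm : forall f, l1 f -> cnorm (T f) <= l1norm f }.

(* (A, iota) is C*(G, omega): the enveloping C*-algebra of l^1(G, omega). *)
Definition twisted_group_cstar (A : cstarType R) (iota : (G -> R[i]) -> A)
    : Prop :=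
  l1_rep iota /\
  forall (B : cstarType R) (T : (G -> R[i]) -> B), l1_rep T ->
    exists! h : A -> B, star_hom h /\ forall f, l1 f -> h (iota f) = T f.

End TwistedGroupAlgebra.

(* Z[1/p] as a subset of the rationals *)
Definition Zinv_pred (p : nat) : {pred rat} :=
  fun q => `[< exists k : nat, q * p%:R ^+ k \is a Num.int >].

Fact Zinv_pred_zmod_closed p : zmod_closed (Zinv_pred p).
Proof.
split=> [|x y /asboolP[k xk] /asboolP[l yl]]; apply/asboolP.
  by exists 0%N; rewrite mul0r rpred0.
have pint n : (p%:R ^+ n : rat) \is a Num.int by rewrite rpredX ?rpred_nat.
exists (k + l)%N; rewrite exprD mulrBl; apply: rpredB.
  by rewrite mulrA rpredM.
by rewrite [_ ^+ k * _]mulrC mulrA rpredM.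
Qed.

HB.instance Definition _ p :=
  GRing.isZmodClosed.Build rat (Zinv_pred p) (Zinv_pred_zmod_closed p).

Record Zinv (p : nat) := MkZinv {
  Zinv_val :> rat ;
  Zinv_valP : Zinv_val \in Zinv_pred p }.

HB.instance Definition _ p := [isSub for @Zinv_val p].
HB.instance Definition _ p := [Choice of Zinv p by <:].
HB.instance Definition _ p := [SubChoice_isSubZmodule of Zinv p by <:].

Section ZinvFractions.
Variable p : nat.

Fact Zinv_expP (x : Zinv p) :
  exists k : nat, (x : rat) * p%:R ^+ k \is a Num.int.
Proof. exact/asboolP/(Zinv_valP x). Qed.

(* x = Zinv_num x / p ^ Zinv_exp x with Zinv_exp x minimal *)
Definition Zinv_exp (x : Zinv p) : nat := ex_minn (Zinv_expP x).

Definition Zinv_num (x : Zinv p) : int :=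
  numq ((x : rat) * p%:R ^+ Zinv_exp x).

Fact Zinv_pinv_subproof n : (p%:R ^- n : rat) \in Zinv_pred p.
Proof.
apply/asboolP; exists n.+1; have [->|p0] := eqVneq (p%:R : rat) 0.
  by rewrite exprS mul0r mulr0 rpred0.
by rewrite exprS mulrCA mulVf ?mulr1 ?rpred_nat // expf_neq0.
Qed.

(* 1 / p ^ n *)
Definition Zinv_pinv (n : nat) : Zinv p := MkZinv (Zinv_pinv_subproof n).

Definition Gamma : Type := (Zinv p * Zinv p)%type.
HB.instance Definition _ := GRing.Zmodule.on Gamma.

End ZinvFractions.

Section Solenoid.
Variables (R : realType) (p : nat).

Definition Omega_even (alpha : nat -> R) : Prop :=
  forall n, exists m : int, p%:R * alpha n.+1 = alpha n + (2 * m)%:~R.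

Definition omega (alpha : nat -> R) (x y : Gamma p) : R[i] :=
  expi (pi *
    (alpha (Zinv_exp x.1 + Zinv_exp y.2)%N * (Zinv_num x.1 * Zinv_num y.2)%:~R
   - alpha (Zinv_exp x.2 + Zinv_exp y.1)%N * (Zinv_num x.2 * Zinv_num y.1)%:~R)).

End Solenoid.

Record SL2Z := MkSL2Z {
  SL2Z_mx :> 'M[int]_2 ;
  SL2Z_det : \det SL2Z_mx == 1 }.

HB.instance Definition _ := [isSub for SL2Z_mx].
HB.instance Definition _ := [Choice of SL2Z by <:].

Section SL2ZGroup.

Fact SL2Z_one_subproof : \det (1%:M : 'M[int]_2) == 1.
Proof. by rewrite det1. Qed.

Fact SL2Z_mul_subproof (M N : SL2Z) : \det (M *m N) == 1.
Proof. by rewrite det_mulmx (eqP (SL2Z_det M)) (eqP (SL2Z_det N)). Qed.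

Fact SL2Z_inv_subproof (M : SL2Z) : \det (invmx M) == 1.
Proof. by rewrite det_inv (eqP (SL2Z_det M)) invr1. Qed.

Definition SL2Z_one : SL2Z := MkSL2Z SL2Z_one_subproof.
Definition SL2Z_mul (M N : SL2Z) : SL2Z := MkSL2Z (SL2Z_mul_subproof M N).
Definition SL2Z_inv (M : SL2Z) : SL2Z := MkSL2Z (SL2Z_inv_subproof M).

Fact SL2Z_unitmx (M : SL2Z) : (M : 'M[int]_2) \in unitmx.
Proof. by rewrite unitmxE (eqP (SL2Z_det M)) unitr1. Qed.

Fact SL2Z_mulA : associative SL2Z_mul.
Proof. by move=> M N P; apply/val_inj; rewrite /= mulmxA. Qed.

Fact SL2Z_mul1 : left_id SL2Z_one SL2Z_mul.
Proof. by move=> M; apply/val_inj; rewrite /= mul1mx. Qed.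

Fact SL2Z_mulr1 : right_id SL2Z_one SL2Z_mul.
Proof. by move=> M; apply/val_inj; rewrite /= mulmx1. Qed.

Fact SL2Z_mulV : left_inverse SL2Z_one SL2Z_inv SL2Z_mul.
Proof. by move=> M; apply/val_inj; rewrite /= mulVmx ?SL2Z_unitmx. Qed.

Fact SL2Z_mulrV : right_inverse SL2Z_one SL2Z_inv SL2Z_mul.
Proof. by move=> M; apply/val_inj; rewrite /= mulmxV ?SL2Z_unitmx. Qed.

HB.instance Definition _ := isGroup.Build SL2Z
  SL2Z_mulA SL2Z_mul1 SL2Z_mulr1 SL2Z_mulV SL2Z_mulrV.

End SL2ZGroup.

Definition SL2Z_act (p : nat) (M : SL2Z) (x : Gamma p) : Gamma p :=
  (x.1 *~ M 0 0 + x.2 *~ M 0 1, x.1 *~ M 1 0 + x.2 *~ M 1 1).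

Section Actions.
Variable R : realType.

Definition star_action (A : cstarType R) (act : SL2Z -> A -> A) : Prop :=
  [/\ forall M, star_aut (act M), act 1%g = id &
      forall M N, act (M * N)%g = act M \o act N].

(* The action lambda of SL_2(Z) on (A, iota) = C*(Gamma_p, omega), determined
   by its values on l^1. *)
Definition canonical_action (p : nat) (A : cstarType R)
    (iota : (Gamma p -> R[i]) -> A) (lambda : SL2Z -> A -> A) : Prop :=
  star_action lambda /\
  forall M f, l1 f -> lambda M (iota f) = iota (fun x => f (SL2Z_act M^-1%g x)).

Definition watatani_brenken (theta : R) (A : cstarType R) (U V : A)
    (act : SL2Z -> A -> A) : Prop :=
  star_action act /\
  forall M : SL2Z,
    let a := M 0 0 in let b := M 0 1 in let c := M 1 0 in let d := M 1 1 in
    act M V = expi (- (pi * (a * c)%:~R * theta)) *: (upow V a * upow U c) /\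
    act M U = expi (- (pi * (b * d)%:~R * theta)) *: (upow V b * upow U d).

(* The action induced on an inductive limit, with canonical maps nu n, by
   actions on the terms of the system. *)
Definition inductive_limit_action (B : nat -> cstarType R) (A : cstarType R)
    (nu : forall n, B n -> A) (act : forall n, SL2Z -> B n -> B n)
    (actlim : SL2Z -> A -> A) : Prop :=
  star_action actlim /\
  forall M n, actlim M \o nu n = nu n \o act n M.

End Actions.

(* Main.v *)
Require Import Defs.
From HB Require Import structures.
From mathcomp Require Import all_boot all_order all_algebra.
From mathcomp Require Import complex.
From mathcomp Require Import all_classical all_reals all_analysis.
From mathcomp Require Import finmap lra.
From mathcomp.analysis.showcase Require summability.

Import Order.TTheory GRing.Theory Num.Theory.
Local Open Scope ring_scope.

(* A unital *-homomorphism of C*-algebras is contractive, so two of them that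
   agree on the unitaries W_x agree on l^1(Gamma_p, omega_alpha) by density of
   the finitely supported functions, and then everywhere by the universal
   property of C*(Gamma_p, omega_alpha). Every x in Gamma_p is of the form
   (a/p^n, b/p^n), and W_x is a scalar multiple of
   W_(1/p^n,0)^a W_(0,1/p^n)^b = nu_n(V^a U^b), so it suffices to compare the
   two actions on nu_n(V) and nu_n(U). There the phases
   e^{-pi i ac alpha_{2n}} and e^{-pi i bd alpha_{2n}} in the Watatani-Brenken
   action cancel the values of omega_alpha that arise in computing V^a U^c and
   V^b U^d. *)

(** * Norm and involution in a C*-algebra *)

Section CstarAlgebraTheory.
Local Open Scope complex_scope.
Context {R : realType} {A : cstarType R}.
Implicit Types x y u : A.

Lemma cabs_real (r : R) : cabs r%:C = `|r|.
Proof. by rewrite /cabs /= expr0n addr0 sqrtr_sqr. Qed.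

Lemma cnorm0 : cnorm (0 : A) = 0.
Proof. by rewrite -(scale0r (0 : A)) cnormZ /cabs ComplexField.Normc.normc0 mul0r. Qed.

Lemma cnormN x : cnorm (- x) = cnorm x.
Proof.
rewrite -scaleN1r cnormZ.
have -> : (-1 : R[i]) = (-1 : R)%:C by rewrite rmorphN1.
by rewrite cabs_real normrN1 mul1r.
Qed.

Lemma cnorm_ge0 x : 0 <= cnorm x.
Proof.
have := cnormD x (- x); rewrite subrr cnorm0 cnormN => h; lra.
Qed.

Lemma cnormB x y : cnorm (x - y) <= cnorm x + cnorm y.
Proof. by rewrite -(cnormN y) cnormD. Qed.

Lemma cdistC x y : cnorm (x - y) = cnorm (y - x).
Proof. by rewrite -cnormN opprB. Qed.

Lemma cnormZr (r : R) x : 0 <= r -> cnorm (r%:C *: x) = r * cnorm x.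
Proof. by move=> r0; rewrite cnormZ cabs_real ger0_norm. Qed.

Lemma starZr (r : R) x : star (r%:C *: x) = r%:C *: star x.
Proof. by rewrite starZ conj_Creal ?complex_real. Qed.

Lemma star1 : star (1 : A) = 1.
Proof. by rewrite -[LHS]mulr1 -[X in _ * X]starK -starM mulr1 starK. Qed.

Lemma star0 : star (0 : A) = 0.
Proof. by apply: (addrI (star 0)); rewrite -starD !addr0. Qed.

Lemma starN x : star (- x) = - star x.
Proof. by apply: (addrI (star x)); rewrite -starD !subrr star0. Qed.

Lemma starB x y : star (x - y) = star x - star y.
Proof. by rewrite starD starN. Qed.

(** The C*-identity and submultiplicativity give |y|^2 <= |star y| |y|, hence |y| <= |star y|; using
    this for [x] and for [star x] yields equality. *)
Lemma cnorm_starE x : cnorm (star x) = cnorm x.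
Proof.
have le y : cnorm y <= cnorm (star y).
  have [->|y0] := eqVneq (cnorm y) 0; first exact: cnorm_ge0.
  have yp : 0 < cnorm y by rewrite lt_def y0 cnorm_ge0.
  by have := cnormM (star y) y; rewrite cnorm_star expr2 ler_pM2r.
by apply/eqP; rewrite eq_le le -{2}(starK x) le.
Qed.

(** By the C*-identity [cnorm 1] equals its own square, and it is nonzero because 1 differs from
    0. *)
Lemma cnorm1 : cnorm (1 : A) = 1.
Proof.
have := cnorm_star (1 : A); rewrite star1 mulr1 expr2 -[LHS]mulr1.
by move/mulfI => -> //; apply/eqP => /cnorm_eq0/eqP; rewrite oner_eq0.
Qed.

Lemma cnorm_unitary u : unitary u -> cnorm u = 1.
Proof.
case=> uu _; have := cnorm_star u; rewrite uu cnorm1 => /esym/eqP.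
by rewrite -[X in _ == X](expr1n _ 2) eqrXn2 ?cnorm_ge0 ?ler01// => /eqP.
Qed.

End CstarAlgebraTheory.

(** * Self-adjoint square roots of 1 - x when |x| < 1 *)

Section SquareRoot.
Import numFieldNormedType.Exports.
Local Open Scope complex_scope.
Context {R : realType} {A : cstarType R} (x : A).
Hypotheses (x_sa : star x = x) (x_lt1 : cnorm x < 1).

(* The fixed point y of y |-> (x + y^2) / 2 satisfies (1 - y)^2 = 1 - x. *)
Let f (y : A) : A := (2^-1 : R)%:C *: (x + y * y).
Let it (n : nat) : A := iter n f 0.

Let half_ge0 : 0 <= 2^-1 :> R. Proof. by rewrite invr_ge0. Qed.

(** With q = |x| < 1, the ball of radius q is stable under [f] because (q + q^2)/2 <= q. *)
Let it_le n : cnorm (it n) <= cnorm x.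
Proof.
elim: n => [|n IH]; first by rewrite cnorm0 cnorm_ge0.
have q0 := cnorm_ge0 x; have n0 := cnorm_ge0 (it n).
rewrite /it iterS cnormZr// ler_pdivrMl//.
apply: le_trans (cnormD _ _) _; rewrite -/(it n).
have h1 := cnormM (it n) (it n).
have h2 := ler_pM n0 n0 IH IH; have h3 := ler_wpM2l q0 (ltW x_lt1); lra.
Qed.

(** Each iterate is a polynomial in [x]. *)
Let it_comm b n : b * x = x * b -> b * it n = it n * b.
Proof.
move=> bx; elim: n => [|n IH]; first by rewrite mulr0 mul0r.
rewrite /it iterS -/(it n) -scalerAr -scalerAl mulrDr mulrDl bx.
by rewrite mulrA IH -!mulrA IH.
Qed.

Let it_sa n : star (it n) = it n.
Proof.
elim: n => [|n IH]; first exact: star0.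
by rewrite /it iterS -/(it n) starZr starD starM IH x_sa.
Qed.

(** For commuting y and z, f(y) - f(z) = (y + z)(y - z)/2, and |y + z| <= 2|x| for iterates. *)
Let it_contract m n :
  cnorm (it m.+1 - it n.+1) <= cnorm x * cnorm (it m - it n).
Proof.
have itx k : it k * x = x * it k by rewrite it_comm.
have -> : it m.+1 - it n.+1 = (2^-1 : R)%:C *: ((it m + it n) * (it m - it n)).
  rewrite /it !iterS -!/(it _) -scalerBr; congr (_ *: _).
  rewrite opprD addrACA subrr add0r mulrDl !mulrBr (it_comm _ n (itx m)).
  by rewrite addrA subrK.
rewrite cnormZr// ler_pdivrMl// mulrA.
apply: le_trans (cnormM _ _) _; apply: ler_wpM2r; first exact: cnorm_ge0.
apply: le_trans (cnormD _ _) _.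
have := it_le m; have := it_le n; lra.
Qed.

Let it_dist N m n :
  cnorm (it (N + m) - it (N + n)) <= cnorm x ^+ N * 2.
Proof.
elim: N => [|N IH].
  rewrite mul1r; apply: le_trans (cnormB _ _) _.
  have := it_le m; have := it_le n; have := x_lt1; rewrite !add0n; lra.
rewrite !addSn; apply: le_trans (it_contract _ _) _.
by rewrite exprS -mulrA ler_wpM2l// cnorm_ge0.
Qed.

(** The root is 1 - l, where l is the limit of the iterates. The commutation clause is what later
    makes b + i sqrt(1 - b^2) unitary. *)
Lemma sqrt_one_sub : exists s : A,
  [/\ star s = s, s * s = 1 - x & forall b, b * x = x * b -> b * s = s * b].
Proof.
have /cnorm_complete[l itl] : forall e : R, 0 < e -> exists N : nat,
    forall m n : nat, (N <= m)%N -> (N <= n)%N -> cnorm (it m - it n) < e.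
  move=> e e0.
  have : (cnorm x ^+ n @[n --> \oo] --> (0:R))%classic.
    by apply: cvg_expr; rewrite ger0_norm ?cnorm_ge0.
  (* The bound e / 2 absorbs the factor 2 in [it_dist]. *)
  move=> /cvgr0Pnorm_lt/(_ (e / 2)) []; first by rewrite divr_gt0.
  move=> N _ /(_ N (leqnn _)) /=; rewrite ger0_norm ?exprn_ge0 ?cnorm_ge0// => hN.
  exists N => m n Nm Nn; rewrite -(subnKC Nm) -(subnKC Nn).
  by apply: le_lt_trans (it_dist _ _ _) _; rewrite -ltr_pdivlMr.
(* Every property of the limit is proved by bounding a defect z by distances of iterates to l. Two
   consecutive distances occur because the fixed-point equation compares [it n] with [it n.+1]. *)
have small (C : R) (z : A) :
  (forall n, cnorm z <= C * (cnorm (it n - l) + cnorm (it n.+1 - l))) -> z = 0.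
  move=> zC; apply: cnorm_eq0; apply/eqP; rewrite eq_le cnorm_ge0 andbT.
  apply/ler_addgt0Pl => e e0; rewrite addr0.
  (* Nothing is assumed about the sign of C, so |C| + 1 serves as a positive divisor. *)
  have D0 : 0 < `|C| + 1 by rewrite ltr_wpDl.
  have [|N hN] := itl (e / (`|C| + 1) / 2); first by rewrite !divr_gt0.
  apply: le_trans (zC N) _.
  have h1 := hN N (leqnn N); have h2 := hN N.+1 (leqnSn N).
  have S0 : 0 <= cnorm (it N - l) + cnorm (it N.+1 - l) by rewrite addr_ge0 ?cnorm_ge0.
  have : cnorm (it N - l) + cnorm (it N.+1 - l) <= e / (`|C| + 1) by lra.
  rewrite ler_pdivlMr// => h.
  apply: le_trans (ler_wpM2r S0 (ler_norm C)) _; lra.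
have l_sa : star l = l.
  apply/eqP; rewrite -subr_eq0; apply/eqP; apply: (small 2) => n.
  rewrite -[star l](subrK (it n)) -{1}(it_sa n) -starB -addrA.
  apply: le_trans (cnormD _ _) _; rewrite cnorm_starE cdistC.
  have := cnorm_ge0 (it n.+1 - l); lra.
have l_comm b : b * x = x * b -> b * l = l * b.
  move=> bx; apply/eqP; rewrite -subr_eq0; apply/eqP.
  apply: (small (2 * cnorm b)) => n.
  have -> : b * l - l * b = (it n - l) * b - b * (it n - l).
    by rewrite mulrBl mulrBr it_comm// opprB [RHS]addrC subrKA.
  apply: le_trans (cnormB _ _) _.
  have h1 := cnormM (it n - l) b; have h2 := cnormM b (it n - l).
  have b0 := cnorm_ge0 b; have := mulr_ge0 b0 (cnorm_ge0 (it n.+1 - l)); nra.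
have l_fix : l = f l.
  apply/eqP; rewrite -subr_eq0; apply/eqP.
  apply: (small (1 + cnorm x + cnorm l)) => n.
  (* Here f(it n) - f(l) is half of (it n)^2 - l^2, split as it n (it n - l) + (it n - l) l, which
     needs no commutation. *)
  have -> : l - f l = (l - it n.+1) +
      (2^-1 : R)%:C *: (it n * (it n - l) + (it n - l) * l).
    rewrite /it iterS -/(it n) mulrBr mulrBl subrKA.
    have -> : it n * it n - l * l = (x + it n * it n) - (x + l * l).
      by rewrite opprD addrACA subrr add0r.
    by rewrite scalerBr subrKA.
  apply: le_trans (cnormD _ _) _; rewrite cnormZr// cdistC.
  have h0 := cnormD (it n * (it n - l)) ((it n - l) * l).
  have h1 := cnormM (it n - l) l; have h2 := cnormM (it n) (it n - l).
  have h3 := it_le n; have h4 := cnorm_ge0 (it n - l).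
  have h5 := cnorm_ge0 (it n.+1 - l); have h6 := cnorm_ge0 x.
  have h7 := cnorm_ge0 l.
  have h8 : cnorm (it n) * cnorm (it n - l) <= cnorm x * cnorm (it n - l) by exact: ler_wpM2r.
  have := mulr_ge0 h6 h5; have := mulr_ge0 h7 h5; have := mulr_ge0 h6 h4.
  have := mulr_ge0 h7 h4; lra.
(* The fixed-point equation reads 2l = x + l^2, so (1 - l)^2 = 1 - (2l - l^2) = 1 - x. *)
exists (1 - l); split; first by rewrite starB star1 l_sa.
  have ll : l + l = x + l * l.
    have e2 : (2 : R)%:C = 1 + 1 by rewrite rmorphD rmorph1.
    have -> : l + l = (2 : R)%:C *: f l by rewrite -l_fix e2 scalerDl scale1r.
    by rewrite scalerA -rmorphM divff ?scale1r// pnatr_eq0.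
  have -> : 1 - x = 1 - (l + l - l * l) by rewrite ll addrK.
  by rewrite mulrBl mul1r mulrBr mulr1 !opprB addrACA -opprD addrA.
by move=> b bx; rewrite mulrBr mulrBl mulr1 mul1r l_comm.
Qed.

End SquareRoot.

(** * Contractivity of unital *-homomorphisms *)

Section StarHom.
Local Open Scope complex_scope.
Context {R : realType} {A B : cstarType R} (h : A -> B).
Hypothesis hh : star_hom h.

Lemma star_homD x y : h (x + y) = h x + h y.
Proof. by rewrite -[x in LHS]scale1r star_hom_lin// scale1r. Qed.

Lemma star_hom0 : h 0 = 0.
Proof. by apply: (addrI (h 0)); rewrite -star_homD !addr0. Qed.

Lemma star_homZ (c : R[i]) x : h (c *: x) = c *: h x.
Proof. by rewrite -[c *: x]addr0 star_hom_lin// star_hom0 addr0. Qed.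

Lemma star_homX x n : h (x ^+ n) = h x ^+ n.
Proof.
by elim: n => [|n IH]; rewrite ?expr0 ?star_hom1// !exprS star_homM// IH.
Qed.

Lemma star_hom_upow x z : h (upow x z) = upow (h x) z.
Proof. by case: z => n; rewrite /upow star_homX// star_hom_star. Qed.

Lemma star_hom_unitary u : unitary u -> unitary (h u).
Proof. by case=> a b; split; rewrite -star_hom_star// -star_homM// ?a ?b star_hom1. Qed.

(* [b + i sqrt(1 - b^2)] is unitary and [b] is its real part. *)
Lemma star_hom_sa_le1 b : star b = b -> cnorm b < 1 -> cnorm (h b) <= 1.
Proof.
move=> bsa b1; have [||s [ssa ss sc]] := @sqrt_one_sub R A (b * b).
- by rewrite starM bsa.
- apply: le_lt_trans (cnormM _ _) _; have := cnorm_ge0 b; nra.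
have {sc} sb := sc b (mulrA b b b).
pose u := b + 'i *: s.
have su : star u = b - 'i *: s.
  by rewrite starD starZ bsa ssa -scaleNr conjCi.
have ii : ('i : R[i]) * 'i = -1 by rewrite -expr2 sqrCi.
have uu : unitary u.
  split; rewrite su.
    rewrite mulrBl !mulrDr -!scalerAr -!scalerAl scalerA ii scaleN1r ss sb.
    by rewrite opprB addrACA subrr addr0 addrC subrK.
  rewrite mulrDl !mulrBr -!scalerAr -!scalerAl scalerA ii scaleN1r ss sb.
  by rewrite opprK addrA subrK addrC subrK.
(* The image of [b] is the mean of a unitary and its adjoint, so its norm is at most 1. *)
have hE : h b = (2^-1 : R)%:C *: (h u + star (h u)).
  rewrite -star_hom_star// -star_homD su addrACA subrr addr0.
  rewrite -star_homZ -[b in b + b]scale1r -scalerDl scalerA.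
  have -> : 1 + 1 = (2:R)%:C :> R[i] by rewrite rmorphD rmorph1.
  by rewrite -rmorphM mulVf ?scale1r// pnatr_eq0.
rewrite hE cnormZr ?invr_ge0// ler_pdivrMl// mulr1.
apply: le_trans (cnormD _ _) _.
by rewrite cnorm_starE cnorm_unitary ?lerD//; exact: star_hom_unitary.
Qed.

(** For r = e + |a|, the self-adjoint element star(a) a / r^2 has norm below 1, so its image has
    norm at most 1. By the C*-identity this says |h a| <= r, and e > 0 is arbitrary. *)
Lemma star_hom_contractive a : cnorm (h a) <= cnorm a.
Proof.
apply/ler_addgt0Pl => e e0; set r := e + _.
have r0 : 0 < r by rewrite ltr_wpDr// cnorm_ge0.
have ar : cnorm a < r by rewrite ltrDr.
have ri : 0 <= r ^- 2 by rewrite invr_ge0 sqr_ge0.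
have := @star_hom_sa_le1 ((r ^- 2)%:C *: (star a * a)).
rewrite star_homZ (star_homM hh) (star_hom_star hh) !cnormZr// !cnorm_star.
rewrite starZr starM starK !ler_pdivrMl ?ltr_pdivrMl ?exprn_gt0//.
rewrite mulr1 !ltr_pXn2r ?ler_pXn2r ?nnegrE ?cnorm_ge0 ?(ltW r0)//.
exact.
Qed.

End StarHom.

(** * Unordered sums and summable functions *)

Section UnorderedSum.
Local Open Scope classical_set_scope.

(** The net of finite partial sums is constant from {i0} on. *)
Lemma unordered_sum_supp1 (I : choiceType) (K : numFieldType)
    (V : normedModType K) (F : I -> V) (i0 : I) :
  (forall i, i != i0 -> F i = 0) -> summability.sum F = F i0.
Proof.
move=> F0; have tF := @summability.totally_filter I.
apply: (@cvg_lim V (@norm_hausdorff K V)).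
apply: cvg_near_cst; exists [fset i0]%fset => // J /fsubsetP/(_ i0 (fset11 _)) Ji0.
rewrite /summability.partial_sum (bigD1 [` Ji0]%fset)//= big1 ?addr0// => j ji.
by apply: F0.
Qed.

End UnorderedSum.

Section SummableFunctions.
Local Open Scope complex_scope.
Local Open Scope classical_set_scope.
Context {R : realType} {G : zmodType}.
Implicit Types (f g : G -> R[i]) (x : G) (s : seq G).

(** The l^1 norm with values in the extended reals, so that sums can be split and compared before
    finiteness is known. *)
Let mass f : \bar R := \esum_(x in [set: G]) (cabs (f x))%:E.

Lemma cabs_ge0 (z : R[i]) : 0 <= cabs z.
Proof. by case: z => a b; rewrite /cabs sqrtr_ge0. Qed.

Let l1E f : l1 f <-> (mass f < +oo)%E.
Proof.
rewrite /l1 /esum.summable /mass.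
suff -> : \esum_(x in [set: G]) `|(cabs (f x))%:E|%E =
  \esum_(x in [set: G]) (cabs (f x))%:E by [].
by apply: eq_esum => x _; rewrite abse_EFin ger0_norm ?cabs_ge0.
Qed.

Let mass_ge0 f : (0 <= mass f)%E.
Proof. by apply: esum_ge0 => x _; rewrite lee_fin cabs_ge0. Qed.

Let l1normE f : l1 f -> (l1norm f)%:E = mass f.
Proof. by move=> /l1E fl; rewrite fineK// ge0_fin_numE ?mass_ge0. Qed.

Lemma le_l1 f g : (forall x, cabs (f x) <= cabs (g x)) -> l1 g -> l1 f.
Proof.
move=> fg /l1E lg; apply/l1E; apply: le_lt_trans lg.
by apply: le_esum => x _; rewrite lee_fin.
Qed.

Definition restr (P : pred G) f : G -> R[i] := fun x => if P x then f x else 0.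

Lemma l1_restr P f : l1 f -> l1 (restr P f).
Proof.
apply: le_l1 => x; rewrite /restr; case: ifP => // _.
by rewrite /cabs ComplexField.Normc.normc0 cabs_ge0.
Qed.

Let mass_restr P f :
  mass (restr P f) = \esum_(x in [set x | P x]) (cabs (f x))%:E.
Proof.
rewrite [RHS]esum_mkcond; apply: eq_esum => x _; rewrite /restr.
have -> : (x \in [set x | P x]) = P x by apply/idP/idP => [/set_mem|Px]//; exact: mem_set.
by case: ifP => // _; rewrite /cabs ComplexField.Normc.normc0.
Qed.

Lemma l1norm_restrC P f : l1 f ->
  l1norm f = l1norm (restr P f) + l1norm (restr (predC P) f).
Proof.
move=> lf; apply/EFin_inj; rewrite EFinD !l1normE//; last 2 first.
  exact: l1_restr.
  exact: l1_restr.
rewrite !mass_restr /mass (esumID [set x | P x])//; last first.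
  by move=> x _; rewrite lee_fin cabs_ge0.
rewrite !setTI; congr (_ + \esum_(x in _) _)%E.
by apply/seteqP; split=> x /= /negP.
Qed.

(** A sum of nonnegative terms is the supremum of its finite partial sums; a finite set whose sum is
    within e of the total leaves mass less than e outside. *)
Lemma l1norm_tail f (e : R) : l1 f -> 0 < e ->
  exists s, l1norm (restr [predC s] f) < e.
Proof.
move=> lf e0; have mfin : mass f \is a fin_num by rewrite -l1normE.
have [_ [S [finS _] <-] hS] := ub_ereal_sup_adherent e0 mfin.
have /finite_seqP[s Ss] := finS; exists s.
have := l1norm_restrC (mem s) f lf => ls.
suff : l1norm f - e < l1norm (restr (mem s) f) by rewrite ls; lra.
rewrite -lte_fin EFinB !l1normE//; last exact: l1_restr.
apply: lt_le_trans hS _; rewrite mass_restr Ss esum_fset//; first exact: finite_seq.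
by move=> x _; rewrite lee_fin cabs_ge0.
Qed.

Lemma l1_delta x : l1 (delta R x).
Proof.
apply/l1E; rewrite [mass _](_ : _ = 1%E) ?ltry//.
(* The constant 1 need not be summable on G; [mass_restr] holds for every function. *)
have -> : delta R x = restr (pred1 x) (fun=> 1).
  by apply/funext => y; rewrite /delta /restr /=; case: eqP.
rewrite mass_restr [X in esum X _](_ : _ = [set x]); last first.
  by apply/seteqP; split=> y /= /eqP.
by rewrite esum_set1 /cabs ComplexField.Normc.normc1// lee_fin ler01.
Qed.

Lemma l1_0 : l1 (fun _ : G => 0 : R[i]).
Proof.
apply: (le_l1 _ (delta R 0) _ (l1_delta 0)) => x.
by rewrite /cabs ComplexField.Normc.normc0 cabs_ge0.
Qed.

End SummableFunctions.

(** * Representations of l^1(G, w) *)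

Section L1Representations.
Local Open Scope complex_scope.
Context {R : realType} {G : zmodType} {w : G -> G -> R[i]}.

(** Only the index y = x contributes to the convolution. The trailing [+ 0] gives the shape c f + g
    that [l1_rep_lin] expects. *)
Lemma tconv_delta (x y : G) :
  tconv w (delta R x) (delta R y) = fun z => w x y * delta R (x + y) z + 0.
Proof.
apply/funext => z; rewrite /tconv addr0 (unordered_sum_supp1 _ _ _ _ x).
  rewrite /delta eqxx mul1r subr_eq [y + x]addrC mulrC.
  by case: eqP => [->|]; rewrite ?mulr0 ?mul0r// [x + y]addrC addrK.
by move=> i /negPf ix; rewrite /delta ix !mul0r.
Qed.

Context {A : cstarType R}.
Implicit Types T : (G -> R[i]) -> A.

Lemma l1_rep0 {T} : l1_rep w T -> T (fun=> 0) = 0.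
Proof.
move=> hT; have := l1_rep_lin hT 1 l1_0 l1_0.
rewrite scale1r (_ : (fun x => _) = (fun=> 0)); last first.
  by apply/funext => x; rewrite mulr0 addr0.
by rewrite -[LHS]addr0 => /addrI.
Qed.

Lemma l1_rep_delta {T} (hT : l1_rep w T) x y :
  T (delta R x) * T (delta R y) = w x y *: T (delta R (x + y)).
Proof.
rewrite -(l1_repM hT) ?tconv_delta; try exact: l1_delta.
by rewrite (l1_rep_lin hT _ (l1_delta _) l1_0) (l1_rep0 hT) addr0.
Qed.

Lemma l1_rep_restr {T} (hT : l1_rep w T) P f : l1 f ->
  T f = T (restr P f) + T (restr (predC P) f).
Proof.
move=> lf; have := l1_rep_lin hT 1 (l1_restr P _ lf) (l1_restr (predC P) _ lf).
rewrite scale1r => <-; congr T; apply/funext => x.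
by rewrite /restr /= mul1r; case: (P x); rewrite ?addr0 ?add0r.
Qed.

(** Linearity settles finitely supported functions; contractivity bounds the rest by the l^1 mass of
    a tail. *)
Lemma l1_rep_ext T1 T2 : l1_rep w T1 -> l1_rep w T2 ->
  (forall x, T1 (delta R x) = T2 (delta R x)) -> forall f, l1 f -> T1 f = T2 f.
Proof.
move=> h1 h2 h12 f lf.
have fin (s : seq G) : T1 (restr (mem s) f) = T2 (restr (mem s) f).
  elim: s => [|x s IH].
    by rewrite (_ : restr _ _ = fun=> 0) ?(l1_rep0 h1) ?(l1_rep0 h2).
  (* A repeated entry leaves the support unchanged; only a new one adds a term f(x) delta_x. *)
  have [xs|xs] := boolP (x \in s).
    rewrite (_ : restr _ _ = restr (mem s) f)//; apply/funext => y.
    by rewrite /restr /= in_cons; case: eqP => // ->; rewrite xs.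
  have -> : restr (mem (x :: s)) f =
      fun y => f x * delta R x y + restr (mem s) f y.
    apply/funext => y; rewrite /restr /delta /= in_cons.
    case: eqP => [->|_]; first by rewrite (negPf xs) mulr1 addr0.
    by rewrite mulr0 add0r.
  have ld := l1_delta (R := R) x; have ls := l1_restr (mem s) f lf.
  by rewrite (l1_rep_lin h1 _ ld ls) (l1_rep_lin h2 _ ld ls) h12 IH.
apply/eqP; rewrite -subr_eq0; apply/eqP/cnorm_eq0/eqP.
rewrite eq_le cnorm_ge0 andbT; apply/ler_addgt0Pl => e e0; rewrite addr0.
(* The tail is paid for twice, once under each representation. *)
have [|s hs] := l1norm_tail f (e / 2) lf; first by rewrite divr_gt0.
rewrite (l1_rep_restr h1 (mem s) f lf) (l1_rep_restr h2 (mem s) f lf) fin.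
rewrite opprD addrACA subrr add0r.
apply: le_trans (cnormB _ _) _.
have lt := l1_restr (predC (mem s)) _ lf.
have := l1_rep_norm h1 lt; have := l1_rep_norm h2 lt; move: hs; rewrite /=.
lra.
Qed.

End L1Representations.

(** * Uniqueness of *-homomorphisms out of C*(G, w) *)

Section TwistedGroupAlgebraHoms.
Context {R : realType} {G : zmodType} {w : G -> G -> R[i]}.
Context {A B : cstarType R}.

(** The norm bound comes from the automatic contractivity of [h]. *)
Lemma star_hom_l1_rep {T} {h : A -> B} :
  l1_rep w T -> star_hom h -> l1_rep w (h \o T).
Proof.
move=> hT hh; split => /=.
- by move=> c f g lf lg; rewrite (l1_rep_lin hT)// (star_hom_lin hh).
- by move=> f g lf lg; rewrite (l1_repM hT)// (star_homM hh).
- by rewrite (l1_rep1 hT) (star_hom1 hh).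
- by move=> f lf; rewrite (l1_rep_star hT)// (star_hom_star hh).
- move=> f lf; apply: le_trans (star_hom_contractive _ hh _) _.
  by have := l1_rep_norm hT lf.
Qed.

(** Both maps extend the representation [h1 \o iota], since [h2 \o iota] agrees with it on l^1;
    uniqueness in the universal property identifies them. *)
Lemma twisted_group_cstar_ext {iota} (h1 h2 : A -> B) :
  twisted_group_cstar w iota -> star_hom h1 -> star_hom h2 ->
  (forall x, h1 (iota (delta R x)) = h2 (iota (delta R x))) -> h1 = h2.
Proof.
case=> hi univ s1 s2 h12.
have [h [_ uh]] := univ _ _ (star_hom_l1_rep hi s1).
rewrite -(uh h1) ?(uh h2)//; split=> // f lf.
have r1 := star_hom_l1_rep hi s1; have r2 := star_hom_l1_rep hi s2.
by have := l1_rep_ext _ _ r2 r1 (fun x => esym (h12 x)) f lf.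
Qed.

End TwistedGroupAlgebraHoms.

(** * The exponential e^{it} *)

Section ComplexExponential.
Local Open Scope complex_scope.
Context {R : realType}.
Implicit Types s t : R.

Lemma expi0 : expi (0 : R) = 1.
Proof. by rewrite /expi cos0 sin0. Qed.

Lemma expiD s t : expi (s + t) = expi s * expi t.
Proof.
by rewrite /expi cosD sinD; apply/eqP; rewrite eq_complex /= [sin s * _ + _]addrC !eqxx.
Qed.

Lemma expiNl t : expi (- t) * expi t = 1.
Proof. by rewrite -expiD addNr expi0. Qed.

Lemma expiN t : expi (- t) = (expi t)^-1.
Proof.
have t0 : expi t != 0.
  by apply/eqP => h; have /eqP := expiNl t; rewrite h mulr0 eq_sym oner_eq0.
by apply: (mulIf t0); rewrite expiNl mulVf.
Qed.

Lemma expi_2pi_int (m : int) : expi (pi * (2 * m)%:~R : R) = 1.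
Proof.
have nat_case (n : nat) : expi (pi * (2 * n%:Z)%:~R : R) = 1.
  elim: n => [|n IH]; first by rewrite mulr0 expi0.
  rewrite intS mulrDr intrD mulrDr expiD IH mulr1 mulr1.
  by rewrite mulrC mulrzl /expi cos2pi sin2pi.
case: m => n; first exact: nat_case.
have -> : 2 * Negz n = - (2 * n.+1%:Z) by rewrite NegzE mulrN.
by rewrite mulrNz mulrN expiN nat_case invr1.
Qed.

End ComplexExponential.

(** * Unreduced fractions over p^n and the multiplier on them *)

Section PInverseFractions.
Context {p : nat}.
Hypothesis p_gt1 : (1 < p)%N.

Let p_neq0 : (p%:R : rat) != 0.
Proof. by rewrite pnatr_eq0 -lt0n ltnW. Qed.

(** The fraction a / p^n, not necessarily in lowest terms. As an integer multiple in the additive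
    group, it reduces sums and matrix actions to the laws of [*~]. *)
Definition frac (n : nat) (a : int) : Zinv p := Zinv_pinv p n *~ a.

Let val_frac n a : val (frac n a) = a%:~R / p%:R ^+ n.
Proof. by rewrite /frac raddfMz /= -mulrzl. Qed.

Lemma Zinv_numE (x : Zinv p) :
  (Zinv_num x)%:~R = (x : rat) * p%:R ^+ Zinv_exp x.
Proof.
rewrite /Zinv_num /Zinv_exp; case: ex_minnP => k /intrP[m ->] _.
by rewrite numq_int.
Qed.

Lemma Zinv_exp_frac n a : (Zinv_exp (frac n a) <= n)%N.
Proof.
rewrite /Zinv_exp; case: ex_minnP => k _; apply.
by rewrite [_ (frac n a)]val_frac divfK ?expf_neq0// rpred_int.
Qed.

Lemma Zinv_num_frac n a :
  Zinv_num (frac n a) * p%:Z ^+ (n - Zinv_exp (frac n a)) = a.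
Proof.
apply: (@intr_inj rat); rewrite rmorphM rmorphXn /= -pmulrn Zinv_numE -mulrA -exprD.
by rewrite subnKC ?Zinv_exp_frac// [_ (frac n a)]val_frac divfK ?expf_neq0.
Qed.

Lemma frac_surj (x : Zinv p) n : (Zinv_exp x <= n)%N ->
  x = frac n (Zinv_num x * p%:Z ^+ (n - Zinv_exp x)).
Proof.
move=> xn; apply: val_inj; rewrite val_frac rmorphM rmorphXn /= -pmulrn Zinv_numE.
by rewrite -(mulrA (x : rat)) -exprD subnKC// mulfK ?expf_neq0.
Qed.

Definition pt (n : nat) (a b : int) : Gamma p := (frac n a, frac n b).

Lemma pt_surj (x : Gamma p) : exists n a b, x = pt n a b.
Proof.
(* The larger of the two minimal exponents gives a common denominator. *)
case: x => x y; exists (maxn (Zinv_exp x) (Zinv_exp y)).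
do 2!eexists; congr pair; apply: frac_surj; [exact: leq_maxl|exact: leq_maxr].
Qed.

Lemma ptD n a b c d : pt n a b + pt n c d = pt n (a + c) (b + d).
Proof. by rewrite /pt /frac !mulrzDr. Qed.

Lemma pt0 n : pt n 0 0 = 0.
Proof. by rewrite /pt /frac !mulr0z. Qed.

Lemma SL2Z_act_pt (M : SL2Z) n a b :
  SL2Z_act M (pt n a b) = pt n (M 0 0 * a + M 0 1 * b) (M 1 0 * a + M 1 1 * b).
Proof. by rewrite /SL2Z_act /pt /frac /= !mulrzDr ![M _ _ * _]mulrC !mulrzA. Qed.

Context {R : realType} {alpha : nat -> R}.
Hypothesis alpha_even : Omega_even p alpha.

(** Since p alpha_{k+1} = alpha_k + 2m, trading one factor p for one index step changes the phase by
    a multiple of 2 pi. Hence the multiplier may be computed from unreduced fractions. *)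
Lemma Omega_even_shift n d (j : int) :
  expi (pi * (alpha (n + d)%N * (j * p%:Z ^+ d)%:~R)) =
  expi (pi * (alpha n * j%:~R)).
Proof.
elim: d => [|d IH]; first by rewrite addn0 mulr1.
have [m am] := alpha_even (n + d).
rewrite -IH addnS exprS.
have -> : alpha (n + d).+1 * (j * (p%:Z * p%:Z ^+ d))%:~R =
  alpha (n + d)%N * (j * p%:Z ^+ d)%:~R + (2 * (m * (j * p%:Z ^+ d)))%:~R.
  rewrite (mulrCA j); set J := j * _.
  rewrite (mulrA 2 m J) (intrM _ (2 * m)) -mulrDl -am intrM -pmulrn.
  by rewrite mulrA [alpha _ * _]mulrC.
by rewrite mulrDr expiD expi_2pi_int mulr1.
Qed.

(** Expanding both minimal exponents to n raises the index of alpha from their sum to 2n, and the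
    cancelled powers of p restore the numerators. *)
Lemma omega_pt n a b c d : omega alpha (pt n a b) (pt n c d) =
  expi (pi * alpha (2 * n)%N * (a * d - b * c)%:~R).
Proof.
have shift x y : expi (pi * (alpha (Zinv_exp (frac n x) + Zinv_exp (frac n y))%N *
    (Zinv_num (frac n x) * Zinv_num (frac n y))%:~R)) =
    expi (pi * (alpha (2 * n)%N * (x * y)%:~R)).
  rewrite -(Omega_even_shift _ ((n - Zinv_exp (frac n x)) + (n - Zinv_exp (frac n y)))).
  rewrite exprD mulrACA !Zinv_num_frac addnACA !subnKC ?Zinv_exp_frac//.
  by rewrite mul2n addnn.
rewrite /omega /= mulrBr expiD expiN !shift -expiN -expiD -mulrBr.
by rewrite -mulrBr -intrB mulrA.
Qed.

End PInverseFractions.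

(** * The action of SL_2(Z) on Gamma_p *)

Section SL2ZAction.
Context {p : nat}.

Lemma sum_ord2 (V : nmodType) (F : 'I_2 -> V) : \sum_i F i = F 0 + F 1.
Proof. by rewrite !big_ord_recl big_ord0 addr0; congr (_ + F _); exact/val_inj. Qed.

Lemma SL2Z_actM (M N : SL2Z) (x : Gamma p) :
  SL2Z_act (M * N)%g x = SL2Z_act M (SL2Z_act N x).
Proof.
have eM i j : SL2Z_mx (M * N)%g i j = M i 0 * N 0 j + M i 1 * N 1 j.
  by rewrite [LHS]mxE sum_ord2.
rewrite /SL2Z_act !eM /=.
by congr pair; rewrite !mulrzDr !mulrzDl -!mulrzA ![N _ _ * _]mulrC addrACA.
Qed.

Lemma SL2Z_act1 (x : Gamma p) : SL2Z_act 1%g x = x.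
Proof.
by rewrite /SL2Z_act /= !mxE /= !mulr1z !mulr0z addr0 add0r -surjective_pairing.
Qed.

Lemma delta_SL2Z_act (R : realType) (M : SL2Z) (x : Gamma p) :
  (fun y => delta R x (SL2Z_act M^-1%g y)) = delta R (SL2Z_act M x).
Proof.
apply/funext => y; rewrite /delta; congr (_ _)%:R; apply/eqP/eqP => [<-|->].
  by rewrite -SL2Z_actM mulgV SL2Z_act1.
by rewrite -SL2Z_actM mulVg SL2Z_act1.
Qed.

End SL2ZAction.

(** * Canonical unitaries and their integer powers *)

Lemma upow_morphism (R : realType) (A : cstarType R) (e : int -> A) :
  e 0 = 1 -> (forall a b, e (a + b) = e a * e b) -> unitary (e 1) ->
  forall z, upow (e 1) z = e z.
Proof.
move=> e0 eD [e1u _].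
have eX a n : e a ^+ n = e (a *+ n).
  by elim: n => [|n IH]; rewrite ?mulr0n ?e0// exprS mulrS eD IH.
(* The adjoint of the unitary [e 1] is its inverse, which is [e (-1)] by additivity. *)
have se1 : star (e 1) = e (-1).
  by rewrite -[LHS]mulr1 -e0 -(subrr 1) eD mulrA e1u mul1r.
case=> n; rewrite /upow ?se1 eX; first by rewrite natz.
by rewrite mulNrn NegzE natz.
Qed.

(** The canonical unitary W_x at x = (a/p^n, b/p^n). *)
Definition W {R : realType} {p : nat} {A : cstarType R}
    (iota : (Gamma p -> R[i]%C) -> A) (n : nat) (a b : int) : A :=
  iota (delta R (pt n a b)).

Section Generators.
Local Open Scope complex_scope.
Context {R : realType} {p : nat}.
Hypothesis p_gt1 : (1 < p)%N.
Context {alpha : nat -> R}.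
Hypothesis alpha_even : Omega_even p alpha.
Context {A : cstarType R} {iota : (Gamma p -> R[i]) -> A}.
Hypothesis iota_rep : l1_rep (@omega R p alpha) iota.

Lemma W_mul n a b c d : W iota n a b * W iota n c d =
  expi (pi * alpha (2 * n)%N * (a * d - b * c)%:~R) *: W iota n (a + c) (b + d).
Proof. by rewrite /W (l1_rep_delta iota_rep) omega_pt// ptD. Qed.

Lemma W_split n a b : W iota n a 0 * W iota n 0 b =
  expi (pi * alpha (2 * n)%N * (a * b)%:~R) *: W iota n a b.
Proof. by rewrite W_mul mulr0 subr0 addr0 add0r. Qed.

(** On a coordinate axis the determinant in the multiplier vanishes, so a |-> W_(a/p^n, 0) is
    multiplicative without phases. *)
Lemma upow_W1 n z : unitary (W iota n 1 0) -> upow (W iota n 1 0) z = W iota n z 0.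
Proof.
move=> u; apply: (@upow_morphism R A (W iota n ^~ 0)) => //= [|a b].
  by rewrite /W pt0 (l1_rep1 iota_rep).
by rewrite W_mul mulr0 mul0r subrr mulr0 expi0 scale1r.
Qed.

Lemma upow_W2 n z : unitary (W iota n 0 1) -> upow (W iota n 0 1) z = W iota n 0 z.
Proof.
move=> u; apply: (@upow_morphism R A (W iota n 0)) => //= [|a b].
  by rewrite /W pt0 (l1_rep1 iota_rep).
by rewrite W_mul mulr0 mul0r subrr mulr0 expi0 scale1r.
Qed.

Lemma star_hom_W_ext {C : cstarType R} (h1 h2 : A -> C) n :
  star_hom h1 -> star_hom h2 -> unitary (W iota n 1 0) -> unitary (W iota n 0 1) ->
  h1 (W iota n 1 0) = h2 (W iota n 1 0) -> h1 (W iota n 0 1) = h2 (W iota n 0 1) ->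
  forall a b, h1 (W iota n a b) = h2 (W iota n a b).
Proof.
move=> s1 s2 u1 u2 e1 e2 a b; set t := pi * alpha (2 * n)%N * (a * b)%:~R.
(* The scalar undoes the phase of [W_split]. *)
have -> : W iota n a b = expi (- t) *: (upow (W iota n 1 0) a * upow (W iota n 0 1) b).
  by rewrite upow_W1// upow_W2// W_split scalerA expiNl scale1r.
rewrite (star_homZ _ s1) (star_homZ _ s2) (star_homM s1) (star_homM s2).
rewrite !(star_hom_upow _ s1) !(star_hom_upow _ s2).
by rewrite e1 e2.
Qed.

End Generators.

(** * Comparison of the two actions on generators *)

Theorem proposition3p9 (R : realType) (p : nat) (hp : (1 < p)%N)
  (alpha : nat -> R) (halpha : Omega_even p alpha)
  (A : cstarType R) (iota : (Gamma p -> R[i]) -> A)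
  (hA : twisted_group_cstar (@omega R p alpha) iota)
  (lambda : SL2Z -> A -> A) (hlambda : canonical_action iota lambda)
  (B : nat -> cstarType R) (U V : forall n, B n)
  (hB : forall n, rotation_algebra (alpha (2 * n)%N) (U n) (V n))
  (phi : forall n, B n -> B n.+1)
  (hphi : forall n, [/\ star_hom (phi n), phi n (U n) = U n.+1 ^+ p
                      & phi n (V n) = V n.+1 ^+ p])
  (nu : forall n, B n -> A)
  (hnu : forall n, [/\ star_hom (nu n),
                       nu n (V n) = iota (delta R (Zinv_pinv p n, 0))
                     & nu n (U n) = iota (delta R (0, Zinv_pinv p n))])
  (wb : forall n, SL2Z -> B n -> B n)
  (hwb : forall n, watatani_brenken (alpha (2 * n)%N) (U n) (V n) (wb n))
  (pitilde : SL2Z -> A -> A)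
  (hpitilde : inductive_limit_action nu wb pitilde) :
  forall M : SL2Z, lambda M = pitilde M.
Proof.
move=> M; have [hi _] := hA.
have [[/(_ M)[ls _] _ _] lE] := hlambda.
have [[/(_ M)[ps _] _ _] pE] := hpitilde.
apply: (twisted_group_cstar_ext _ _ hA ls ps) => x.
(* The level n depends on x; from here on only the n-th rotation algebra matters. *)
have [n [a [b ->]]] := pt_surj hp x.
have [ns nV nU] := hnu n; have [[uU uV _] _] := hB n.
have [_ /(_ M)[wV wU]] := hwb n.
have {nV} nV : nu n (V n) = W iota n 1 0.
  by rewrite nV /W /pt /frac mulr1z mulr0z.
have {nU} nU : nu n (U n) = W iota n 0 1.
  by rewrite nU /W /pt /frac mulr1z mulr0z.
have u1 : unitary (W iota n 1 0) by rewrite -nV; exact: star_hom_unitary.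
have u2 : unitary (W iota n 0 1) by rewrite -nU; exact: star_hom_unitary.
(* The canonical action permutes the unitaries W_x without phases, since it sends delta_x to
   delta_{Mx}. *)
have lW c d : lambda M (W iota n c d) =
    W iota n (M 0 0 * c + M 0 1 * d) (M 1 0 * c + M 1 1 * d).
  by rewrite /W lE ?delta_SL2Z_act ?SL2Z_act_pt//; exact: l1_delta.
(* An arbitrary column (c, d) covers both generators: the first column of M for V, the second for U.
   The Watatani-Brenken phase is the inverse of the one in [W_split]. *)
have pW y c d :
    wb n M y = expi (- (pi * (c * d)%:~R * alpha (2 * n)%N)) *:
      (upow (V n) c * upow (U n) d) ->
    pitilde M (nu n y) = W iota n c d.
  move=> e; have /= -> := congr1 (@^~ y) (pE M n); rewrite e (star_homZ _ ns).
  rewrite (star_homM ns) !(star_hom_upow _ ns) nV nU.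
  rewrite (upow_W1 hp halpha hi)// (upow_W2 hp halpha hi)// (W_split hp halpha hi).
  by rewrite scalerA [pi * _ * alpha _]mulrAC expiNl scale1r.
apply: (star_hom_W_ext hp halpha hi) => //.
  by rewrite lW !mulr1 !mulr0 !addr0 -nV; exact/esym/pW.
by rewrite lW !mulr1 !mulr0 !add0r -nU; exact/esym/pW.
Qed.
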